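(* $\mathsf{iSL}_{\mathsf a}$ proves the explicit fixed point principle $\top\mathsf F$: for every propositional variable $r$ and every formula $\chi$ of $\mathbb L(\rightsquigarrow)$ modalised in $r$, $$\mathsf{iSL}_{\mathsf a}\vdash\chi[r:\top]\leftrightarrow\chi\big[r:\chi[r:\top]\big].$$
   Context: Formulas of $\mathbb L(\rightsquigarrow)$ are built from propositional variables, $\top,\bot$, and binary connectives $\wedge,\vee,\to,\rightsquigarrow$. Abbreviations: $(\phi\leftrightarrow\psi):=((\phi\to\psi)\wedge(\psi\to\phi))$ and $\Box\phi:=(\top\rightsquigarrow\phi)$. $\chi[r:\phi]$ denotes the result of substituting $\phi$ for $r$ in $\chi$. A formula $\chi$ is modalised in $r$ if every occurrence of $r$ in $\chi$ is in the scope of an occurrence of $\rightsquigarrow$. The system $\mathsf{HLC}^\sharp$ is axiomatised by all axioms and rules of intuitionistic propositional logic, the rule: from $\vdash\phi\to\psi$ infer $\vdash\phi\rightsquigarrow\psi$, and the axiom schemes $((\phi\rightsquigarrow\psi)\wedge(\psi\rightsquigarrow\chi))\to(\phi\rightsquigarrow\chi)$, $((\phi\rightsquigarrow\psi)\wedge(\phi\rightsquigarrow\chi))\to(\phi\rightsquigarrow(\psi\wedge\chi))$, $((\phi\rightsquigarrow\chi)\wedge(\psi\rightsquigarrow\chi))\to((\phi\vee\psi)\rightsquigarrow\chi)$. $\mathsf{iSL}_{\mathsf a}$ is $\mathsf{HLC}^\sharp$ plus the axiom scheme $(\Box\phi\to\phi)\to\phi$ (all rules applying to the extended system). *)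

(* Defs.v *)
From Stdlib Require Import Arith.

Inductive form : Type :=
| Var (p : nat)
| Top
| Bot
| And (phi psi : form)
| Or (phi psi : form)
| Imp (phi psi : form)
| Strict (phi psi : form).

Declare Scope form_scope.
Delimit Scope form_scope with form.
Bind Scope form_scope with form.

Notation "phi '⊓' psi" := (And phi psi)
  (at level 40, left associativity) : form_scope.
Notation "phi '⊔' psi" := (Or phi psi)
  (at level 50, left associativity) : form_scope.
Notation "phi '⇝' psi" := (Strict phi psi)
  (at level 54, no associativity) : form_scope.
Notation "phi '⊃' psi" := (Imp phi psi)
  (at level 55, right associativity) : form_scope.

Local Open Scope form_scope.

Definition Iff (phi psi : form) : form := (phi ⊃ psi) ⊓ (psi ⊃ phi).
Definition Box (phi : form) : form := Top ⇝ phi.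

(* [subst r phi chi] is chi[r : phi]. *)
Fixpoint subst (r : nat) (phi chi : form) : form :=
  match chi with
  | Var p => if Nat.eqb p r then phi else Var p
  | Top => Top
  | Bot => Bot
  | a ⊓ b => subst r phi a ⊓ subst r phi b
  | a ⊔ b => subst r phi a ⊔ subst r phi b
  | a ⊃ b => subst r phi a ⊃ subst r phi b
  | a ⇝ b => subst r phi a ⇝ subst r phi b
  end.

(* Everything below a [⇝], on either side, is in its scope, so the recursion
   visits exactly the occurrences of variables outside every such scope. *)
Fixpoint modalised (r : nat) (chi : form) : Prop :=
  match chi with
  | Var p => p <> r
  | Top | Bot => True
  | a ⊓ b | a ⊔ b | a ⊃ b => modalised r a /\ modalised r b
  | _ ⇝ _ => True
  end.

(* A standard Hilbert axiomatisation of intuitionistic propositional logic,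
   over formulas of the whole language. *)
Inductive ipl_axiom : form -> Prop :=
| ax_K phi psi : ipl_axiom (phi ⊃ psi ⊃ phi)
| ax_S phi psi chi :
    ipl_axiom ((phi ⊃ psi ⊃ chi) ⊃ (phi ⊃ psi) ⊃ phi ⊃ chi)
| ax_and_l phi psi : ipl_axiom (phi ⊓ psi ⊃ phi)
| ax_and_r phi psi : ipl_axiom (phi ⊓ psi ⊃ psi)
| ax_and_i phi psi : ipl_axiom (phi ⊃ psi ⊃ phi ⊓ psi)
| ax_or_l phi psi : ipl_axiom (phi ⊃ phi ⊔ psi)
| ax_or_r phi psi : ipl_axiom (psi ⊃ phi ⊔ psi)
| ax_or_e phi psi chi :
    ipl_axiom ((phi ⊃ chi) ⊃ (psi ⊃ chi) ⊃ phi ⊔ psi ⊃ chi)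
| ax_top : ipl_axiom Top
| ax_bot phi : ipl_axiom (Bot ⊃ phi).

Inductive hlc_axiom : form -> Prop :=
| ax_trans phi psi chi :
    hlc_axiom ((phi ⇝ psi) ⊓ (psi ⇝ chi) ⊃ (phi ⇝ chi))
| ax_conj phi psi chi :
    hlc_axiom ((phi ⇝ psi) ⊓ (phi ⇝ chi) ⊃ (phi ⇝ (psi ⊓ chi)))
| ax_disj phi psi chi :
    hlc_axiom ((phi ⇝ chi) ⊓ (psi ⇝ chi) ⊃ ((phi ⊔ psi) ⇝ chi)).

(* Theoremhood in HLC♯ extended with the axioms [X]; as there are no open
   premises, [thm_nec] applies to theorems only. *)
Inductive HLCsharp_plus (X : form -> Prop) : form -> Prop :=
| thm_ipl phi : ipl_axiom phi -> HLCsharp_plus X phi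
| thm_hlc phi : hlc_axiom phi -> HLCsharp_plus X phi
| thm_extra phi : X phi -> HLCsharp_plus X phi
| thm_mp phi psi :
    HLCsharp_plus X (phi ⊃ psi) -> HLCsharp_plus X phi -> HLCsharp_plus X psi
| thm_nec phi psi :
    HLCsharp_plus X (phi ⊃ psi) -> HLCsharp_plus X (phi ⇝ psi).

Inductive strong_loeb_axiom : form -> Prop :=
| ax_SL phi : strong_loeb_axiom ((Box phi ⊃ phi) ⊃ phi).

Definition iSLa : form -> Prop := HLCsharp_plus strong_loeb_axiom.

(* Main.v *)
Require Import Defs.
From Stdlib Require Import Arith List.
Import ListNotations.

(** The strong Löb axiom makes every formula imply its own box: given [phi], put
    [alpha := phi ⊓ Box phi]; then [Box alpha ⊃ alpha], because [Box alpha]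
    yields [Box phi], and so [alpha] holds ([box_intro]). Moreover
    [Box (a ⊃ b)] implies [a ⇝ b] ([strict_of_box_imp]), so both arguments of
    [⇝] may be exchanged for formulas that are boxed-equivalent to them
    ([strict_congr]). Two replacement principles follow by induction on [chi].

    - [subst_congr]: [Iff phi psi] implies [Iff chi[r : phi] chi[r : psi]] for
      every [chi]. Under [⇝] the hypothesis is needed in boxed form, and
      [box_intro] supplies the box.
    - [subst_congr_modalised]: if [chi] is modalised in [r], then already
      [Box (Iff phi psi)] suffices, as the replacement happens only under [⇝].

    Let [A := chi[r : Top]]. Given [A], the formulas [Top] and [A] are
    equivalent, so the first principle turns [A] into [chi[r : A]]. Given
    [chi[r : A]], the strong Löb axiom allows [Box A] to be assumed in proving
    [A]; then [Top] and [A] are boxed-equivalent, and the second principle turns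
    [chi[r : A]] into [chi[r : Top]], which is [A]. *)

Local Open Scope form_scope.

(** * Derivability from premises *)

(** Necessitation enters only through
    theorems, in [ent_thm], which is what makes the deduction theorem hold. *)
Inductive entails (X : form -> Prop) (G : list form) : form -> Prop :=
| ent_thm a : HLCsharp_plus X a -> entails X G a
| ent_hyp a : In a G -> entails X G a
| ent_mp a b : entails X G (a ⊃ b) -> entails X G a -> entails X G b.

Arguments ent_thm {X G a}.
Arguments ent_hyp {X G a}.
Arguments ent_mp {X G a b}.

Ltac hyp := apply ent_hyp; simpl; tauto.

Lemma ent_ipl {X G a} : ipl_axiom a -> entails X G a.
Proof. intros H; apply ent_thm, thm_ipl, H. Qed.

Lemma ent_hlc {X G a} : hlc_axiom a -> entails X G a.
Proof. intros H; apply ent_thm, thm_hlc, H. Qed.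

Lemma ent_weaken {X G H a} : incl G H -> entails X G a -> entails X H a.
Proof.
  intros GH D; induction D as [a Ha | a Ha | a b _ IHab _ IHa].
  - exact (ent_thm Ha).
  - exact (ent_hyp (GH a Ha)).
  - exact (ent_mp IHab IHa).
Qed.

Lemma ent_weaken_cons {X G a b} : entails X G b -> entails X (a :: G) b.
Proof. apply ent_weaken, incl_tl, incl_refl. Qed.

Lemma entails_nil {X a} : entails X [] a -> HLCsharp_plus X a.
Proof.
  induction 1 as [a Ha | a [] | a b _ IHab _ IHa].
  - exact Ha.
  - exact (thm_mp X a b IHab IHa).
Qed.

(** * Natural deduction for the intuitionistic connectives *)

Lemma imp_refl {X G} a : entails X G (a ⊃ a).
Proof.
  exact (ent_mp (ent_mp (ent_ipl (ax_S a (a ⊃ a) a)) (ent_ipl (ax_K a (a ⊃ a))))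
           (ent_ipl (ax_K a a))).
Qed.

(** The deduction theorem: axioms K and S carry the discharged premise through
    modus ponens, the only rule that combines open derivations. *)
Lemma imp_intro {X G a b} : entails X (a :: G) b -> entails X G (a ⊃ b).
Proof.
  induction 1 as [b Hb | b [<- | Hb] | b c _ IHbc _ IHb].
  - exact (ent_mp (ent_ipl (ax_K b a)) (ent_thm Hb)).
  - apply imp_refl.
  - exact (ent_mp (ent_ipl (ax_K b a)) (ent_hyp Hb)).
  - exact (ent_mp (ent_mp (ent_ipl (ax_S a b c)) IHbc) IHb).
Qed.

Lemma entails_cut {X G a b} : entails X [a] b -> entails X G a -> entails X G b.
Proof.
  intros H; apply ent_mp, ent_thm, entails_nil, imp_intro, H.
Qed.

Lemma top_intro {X G} : entails X G Top.
Proof. exact (ent_ipl ax_top). Qed.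

Lemma and_intro {X G a b} :
  entails X G a -> entails X G b -> entails X G (a ⊓ b).
Proof. intros Ha; apply ent_mp, (ent_mp (ent_ipl (ax_and_i a b)) Ha). Qed.

Lemma and_elim_l {X G a b} : entails X G (a ⊓ b) -> entails X G a.
Proof. apply ent_mp, ent_ipl, ax_and_l. Qed.

Lemma and_elim_r {X G a b} : entails X G (a ⊓ b) -> entails X G b.
Proof. apply ent_mp, ent_ipl, ax_and_r. Qed.

Lemma or_mono {X G a b a' b'} :
  entails X G (a ⊃ a') -> entails X G (b ⊃ b') ->
  entails X G (a ⊔ b ⊃ a' ⊔ b').
Proof.
  intros Ha Hb.
  refine (ent_mp (ent_mp (ent_ipl (ax_or_e a b (a' ⊔ b'))) _) _);
    apply imp_intro.
  - refine (ent_mp (ent_ipl (ax_or_l a' b')) (ent_mp (ent_weaken_cons Ha) _)); hyp.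
  - refine (ent_mp (ent_ipl (ax_or_r a' b')) (ent_mp (ent_weaken_cons Hb) _)); hyp.
Qed.

Lemma and_mono {X G a b a' b'} :
  entails X G (a ⊃ a') -> entails X G (b ⊃ b') ->
  entails X G (a ⊓ b ⊃ a' ⊓ b').
Proof.
  intros Ha Hb; apply imp_intro, and_intro.
  - refine (ent_mp (ent_weaken_cons Ha) (and_elim_l (b := b) _)); hyp.
  - refine (ent_mp (ent_weaken_cons Hb) (and_elim_r (a := a) _)); hyp.
Qed.

Lemma imp_trans {X G a b c} :
  entails X G (a ⊃ b) -> entails X G (b ⊃ c) -> entails X G (a ⊃ c).
Proof.
  intros Hab Hbc; apply imp_intro.
  refine (ent_mp (ent_weaken_cons Hbc) (ent_mp (ent_weaken_cons Hab) _)); hyp.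
Qed.

Lemma imp_mono {X G a b a' b'} :
  entails X G (a' ⊃ a) -> entails X G (b ⊃ b') ->
  entails X G ((a ⊃ b) ⊃ (a' ⊃ b')).
Proof.
  intros Ha Hb; apply imp_intro.
  refine (imp_trans (ent_weaken_cons Ha) (imp_trans _ (ent_weaken_cons Hb))); hyp.
Qed.

Lemma iff_refl {X G} a : entails X G (Iff a a).
Proof. apply and_intro; apply imp_refl. Qed.

Lemma and_congr {X G a b a' b'} :
  entails X G (Iff a a') -> entails X G (Iff b b') ->
  entails X G (Iff (a ⊓ b) (a' ⊓ b')).
Proof.
  intros Ha Hb; apply and_intro; apply and_mono;
    (eapply and_elim_l; eassumption) || (eapply and_elim_r; eassumption).
Qed.

Lemma or_congr {X G a b a' b'} :
  entails X G (Iff a a') -> entails X G (Iff b b') ->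
  entails X G (Iff (a ⊔ b) (a' ⊔ b')).
Proof.
  intros Ha Hb; apply and_intro; apply or_mono;
    (eapply and_elim_l; eassumption) || (eapply and_elim_r; eassumption).
Qed.

Lemma imp_congr {X G a b a' b'} :
  entails X G (Iff a a') -> entails X G (Iff b b') ->
  entails X G (Iff (a ⊃ b) (a' ⊃ b')).
Proof.
  intros Ha Hb; apply and_intro; apply imp_mono;
    (eapply and_elim_l; eassumption) || (eapply and_elim_r; eassumption).
Qed.

Lemma iff_top {X G a} : entails X G a -> entails X G (Iff Top a).
Proof.
  intros Ha; apply and_intro; apply imp_intro.
  - exact (ent_weaken_cons Ha).
  - exact top_intro.
Qed.

(** * Strict implication *)

Lemma strict_nec {X G a b} : entails X [a] b -> entails X G (a ⇝ b).
Proof. intros H; apply ent_thm, thm_nec, entails_nil, imp_intro, H. Qed.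

Lemma strict_trans {X G} a b c :
  entails X G (a ⇝ b) -> entails X G (b ⇝ c) -> entails X G (a ⇝ c).
Proof.
  intros Hab Hbc; exact (ent_mp (ent_hlc (ax_trans a b c)) (and_intro Hab Hbc)).
Qed.

Lemma box_mono {X G a b} :
  entails X [a] b -> entails X G (Box a) -> entails X G (Box b).
Proof. intros H Ha; exact (strict_trans Top a b Ha (strict_nec H)). Qed.

(** Since [a ⇝ Top] always holds, [Box (a ⊃ b)] gives [a ⇝ (a ⊃ b)]; joined
    with [a ⇝ a], this is modus ponens in the consequent. *)
Lemma strict_of_box_imp {X G a b} :
  entails X G (Box (a ⊃ b)) -> entails X G (a ⇝ b).
Proof.
  intros H; apply (strict_trans a ((a ⊃ b) ⊓ a) b).
  - refine (ent_mp (ent_hlc (ax_conj a (a ⊃ b) a)) (and_intro _ _)).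
    + exact (strict_trans a Top (a ⊃ b) (strict_nec top_intro) H).
    + apply strict_nec; hyp.
  - apply strict_nec.
    refine (ent_mp (and_elim_l (b := a) _) (and_elim_r (a := a ⊃ b) _)); hyp.
Qed.

Lemma strict_mono {X G a b a' b'} :
  entails X G (Box (a' ⊃ a)) -> entails X G (Box (b ⊃ b')) ->
  entails X G ((a ⇝ b) ⊃ (a' ⇝ b')).
Proof.
  intros Ha Hb; apply imp_intro.
  apply (strict_trans a' a b'); [| apply (strict_trans a b b')].
  - exact (ent_weaken_cons (strict_of_box_imp Ha)).
  - hyp.
  - exact (ent_weaken_cons (strict_of_box_imp Hb)).
Qed.

(** The single premise [c] stands for the equivalence being substituted: its
    box carries both equivalences under [⇝]. *)
Lemma strict_congr {X G} c {a b a' b'} :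
  entails X [c] (Iff a a') -> entails X [c] (Iff b b') ->
  entails X G (Box c) -> entails X G (Iff (a ⇝ b) (a' ⇝ b')).
Proof.
  intros Ha Hb Hc; apply and_intro; apply strict_mono;
    refine (box_mono _ Hc);
    (eapply and_elim_l; eassumption) || (eapply and_elim_r; eassumption).
Qed.

(** * Consequences of the strong Löb axiom *)

Lemma strong_loeb {G a} :
  entails strong_loeb_axiom (Box a :: G) a -> entails strong_loeb_axiom G a.
Proof.
  intros H.
  exact (ent_mp (ent_thm (thm_extra _ _ (ax_SL a))) (imp_intro H)).
Qed.

(** Strong Löb is applied to [a ⊓ Box a] rather than to [Box a]: boxing the
    conjunction is what returns [Box a] from the Löb hypothesis. *)
Lemma box_intro {G a} :
  entails strong_loeb_axiom G a -> entails strong_loeb_axiom G (Box a).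
Proof.
  intros Ha; apply (and_elim_r (a := a)), strong_loeb, and_intro.
  - exact (ent_weaken_cons Ha).
  - apply (box_mono (a := a ⊓ Box a)); [apply (and_elim_l (b := Box a)) |]; hyp.
Qed.

Lemma subst_congr r phi psi chi :
  entails strong_loeb_axiom [Iff phi psi]
    (Iff (subst r phi chi) (subst r psi chi)).
Proof.
  induction chi as [p | | | a IHa b IHb | a IHa b IHb | a IHa b IHb | a IHa b IHb];
    cbn [subst].
  - destruct (Nat.eqb p r); [hyp | apply iff_refl].
  - apply iff_refl.
  - apply iff_refl.
  - exact (and_congr IHa IHb).
  - exact (or_congr IHa IHb).
  - exact (imp_congr IHa IHb).
  - apply (strict_congr _ IHa IHb), box_intro; hyp.
Qed.

(** The arguments of [⇝] may contain [r] outside every further [⇝], so they are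
    beyond the reach of this induction; [subst_congr] treats them, and
    [strict_congr] turns its unboxed premise into a boxed one. *)
Lemma subst_congr_modalised r phi psi chi :
  modalised r chi ->
  entails strong_loeb_axiom [Box (Iff phi psi)]
    (Iff (subst r phi chi) (subst r psi chi)).
Proof.
  induction chi as [p | | | a IHa b IHb | a IHa b IHb | a IHa b IHb | a _ b _];
    cbn [subst modalised]; intros M.
  - apply Nat.eqb_neq in M; rewrite M; apply iff_refl.
  - apply iff_refl.
  - apply iff_refl.
  - exact (and_congr (IHa (proj1 M)) (IHb (proj2 M))).
  - exact (or_congr (IHa (proj1 M)) (IHb (proj2 M))).
  - exact (imp_congr (IHa (proj1 M)) (IHb (proj2 M))).
  - apply (strict_congr (Iff phi psi)); [apply subst_congr | apply subst_congr | hyp].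
Qed.

Theorem theorem3p12 (r : nat) (chi : form) (hchi : modalised r chi) :
  iSLa (Iff (subst r Top chi) (subst r (subst r Top chi) chi)).
Proof.
  set (A := subst r Top chi).
  apply entails_nil, and_intro; apply imp_intro.
  - assert (E : entails strong_loeb_axiom [A] (Iff A (subst r A chi))).
    { apply (entails_cut (subst_congr r Top A chi)), iff_top; hyp. }
    apply (ent_mp (and_elim_l E)); hyp.
  - apply strong_loeb.
    assert (E : entails strong_loeb_axiom [Box A; subst r A chi]
                  (Iff A (subst r A chi))).
    { apply (entails_cut (subst_congr_modalised r Top A chi hchi)).
      apply (box_mono (a := A)); [apply iff_top |]; hyp. }
    apply (ent_mp (and_elim_r E)); hyp.
Qed.
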